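(* Let $\theta>0$ and $n\ge 3$. Let $\eta=(\eta_n,\ldots,\eta_1)$ be the random vector whose law is that of $(\xi_n,\ldots,\xi_1)$ conditioned on the event $\{(\xi_n,\ldots,\xi_1)\in\Delta_n\}$, and set $\eta_{n+1}=1$. Then: (i) The sequence $\eta_{n+1}=1,\eta_n,\eta_{n-1},\ldots,\eta_2,\eta_1$ (in this order) is a non-homogeneous Markov chain on $\{0,1\}$. Its transitions are as follows. $\eta_n=0$ almost surely. For $r=3,\ldots,n-1$, $$\mathbb{P}(\eta_r=0\mid \eta_{r+1}=0)=\frac{(\theta+r-1)\lambda_r(\theta)}{(\theta+r-1)\lambda_r(\theta)+\theta\lambda_{r-1}(\theta)},\qquad \mathbb{P}(\eta_r=1\mid \eta_{r+1}=0)=\frac{\theta\lambda_{r-1}(\theta)}{(\theta+r-1)\lambda_r(\theta)+\theta\lambda_{r-1}(\theta)},$$ $$\mathbb{P}(\eta_r=0\mid \eta_{r+1}=1)=1,\qquad \mathbb{P}(\eta_r=1\mid \eta_{r+1}=1)=0.$$ Moreover $\eta_2=0$ almost surely and $\eta_1=1$ almost surely. (ii) For $j=2,\ldots,n$, let $\tilde C_j(n)$ be the number of $j$-spacings in the sequence $1\,\eta_n\,\eta_{n-1}\cdots\eta_2\,\eta_1$. Then $(\tilde C_2(n),\ldots,\tilde C_n(n))$ has the law of $(C_2(n),\ldots,C_n(n))$ conditioned on $C_1(n)=0$, where $(C_1(n),\ldots,C_n(n))\sim \mathrm{ESF}(\theta)$.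
   Context: Fix $\theta>0$. Write $\theta_{(0)}=1$ and $\theta_{(m)}=\theta(\theta+1)\cdots(\theta+m-1)$ for $m\ge1$. The Ewens Sampling Formula $\mathrm{ESF}(\theta)$ is the law of a random vector $(C_1(n),\ldots,C_n(n))$ of nonnegative integers with $$\mathbb{P}(C_1(n)=c_1,\ldots,C_n(n)=c_n)=\frac{n!}{\theta_{(n)}}\prod_{j=1}^n\Big(\frac{\theta}{j}\Big)^{c_j}\frac{1}{c_j!}\quad\text{whenever } \textstyle\sum_j jc_j=n$$ (these are the cycle counts of a random permutation of $\{1,\ldots,n\}$ chosen with probability $\theta^{k}/\theta_{(n)}$ when it has $k$ cycles). For $n\ge1$ let $\lambda_n(\theta)=\mathbb{P}(C_1(n)=0)=\frac{n!}{\theta_{(n)}}\sum_{j=0}^n(-1)^j\frac{\theta^j}{j!}\frac{\theta_{(n-j)}}{(n-j)!}$, and $\lambda_0(\theta)=1$; note $\lambda_1(\theta)=0$. Let $\xi_1,\xi_2,\ldots$ be independent Bernoulli random variables with $\mathbb{P}(\xi_i=1)=\theta/(\theta+i-1)$, $\mathbb{P}(\xi_i=0)=(i-1)/(\theta+i-1)$ (so $\xi_1=1$). For $n\ge2$, $\Delta_n$ is the set of $(a_n,a_{n-1},\ldots,a_1)\in\{0,1\}^n$ with $a_n=0$, $a_1=1$, and no index $2\le i\le n$ with $a_i=a_{i-1}=1$. (One has $\mathbb{P}((\xi_n,\ldots,\xi_1)\in\Delta_n)=\lambda_n(\theta)$.) For a finite $\{0,1\}$-sequence, a $j$-spacing is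 an occurrence of two consecutive 1s separated by exactly $j-1$ zeros, i.e. an occurrence of the pattern $1\,0^{j-1}\,1$. *)

(* Defs.v *)
From HB Require Import structures.
From mathcomp Require Import all_boot all_order all_algebra.
Unset Printing Implicit Defensive.
Import Order.TTheory GRing.Theory Num.Theory.
Local Open Scope ring_scope.

Section Defs.
Variable R : realFieldType.

Definition rfact (th : R) (m : nat) : R := \prod_(i < m) (th + i%:R).

Definition lambda (th : R) (n : nat) : R :=
  if n == 0%N then 1 else
  (n`!)%:R / rfact th n *
  \sum_(j < n.+1) ((-1) ^+ j * th ^+ j / (j`!)%:R * rfact th (n - j) / ((n - j)`!)%:R).

(* A vector (a_n,...,a_1) is stored as a tuple t with t`_(i-1) = a_i. *)
Definition comp {n} (t : n.-tuple bool) (i : nat) : bool := nth false t i.-1.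

(* law of (xi_n,...,xi_1): P(xi_i = 1) = th/(th+i-1), P(xi_i=0) = (i-1)/(th+i-1) *)
Definition xi_weight (th : R) {n} (t : n.-tuple bool) : R :=
  \prod_(k < n) (if nth false t k then th / (th + k%:R) else k%:R / (th + k%:R)).

Definition inDelta {n} (t : n.-tuple bool) : bool :=
  [&& ~~ comp t n, comp t 1 &
      [forall i : 'I_n.+1, (2 <= i)%N ==> ~~ (comp t i && comp t i.-1)]].

Definition PEta (th : R) (n : nat) (E : pred (n.-tuple bool)) : R :=
  (\sum_(t : n.-tuple bool | inDelta t && E t) xi_weight th t) /
  (\sum_(t : n.-tuple bool | inDelta t) xi_weight th t).

Definition PEtaCond (th : R) (n : nat) (E F : pred (n.-tuple bool)) : R :=
  PEta th n (predI E F) / PEta th n F.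

Definition etav {n} (t : n.-tuple bool) (i : nat) : bool :=
  if i == n.+1 then true else comp t i.

Definition spacings (j : nat) (s : seq bool) : nat :=
  \sum_(p < size s)
     [&& nth false s p, nth false s (p + j) &
         [forall k : 'I_j, (0 < k)%N ==> ~~ nth false s (p + k)]].

Definition esf_pmf (th : R) (n : nat) (c : nat -> nat) : R :=
  if (\sum_(1 <= j < n.+1) j * c j)%N == n then
    (n`!)%:R / rfact th n *
    \prod_(1 <= j < n.+1) ((th / j%:R) ^+ c j / ((c j)`!)%:R)
  else 0.

(* a vector (c_1,...,c_n) with entries in {0..n} (this contains the support) *)
Definition cvec {n} (c : n.-tuple 'I_n.+1) (j : nat) : nat :=
  if (0 < j <= n)%N then nth 0%N [seq val x | x <- c] j.-1 else 0%N.

Definition PESF (th : R) (n : nat) (E : (nat -> nat) -> bool) : R :=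
  \sum_(c : n.-tuple 'I_n.+1 | E (cvec c)) esf_pmf th n (cvec c).

End Defs.
Arguments rfact {R}. Arguments lambda {R}. Arguments xi_weight {R}. Arguments PEta {R}. Arguments PEtaCond {R}. Arguments esf_pmf {R}. Arguments PESF {R}.

(* Main.v *)
Require Import Defs.
From HB Require Import structures.
From mathcomp Require Import all_boot all_order all_algebra ring zify.
Import Order.TTheory GRing.Theory Num.Theory.
Local Open Scope ring_scope.

(** Clearing the denominators [th + i - 1], a 0-1 word [(a_n, ..., a_1)] gets the
    product weight [th] for each one and [i - 1] for a zero at index [i].

    The total weight [d_n] of [Delta_n] satisfies
    [d_(n+2) = (n+1) (d_(n+1) + th d_n)] (look at the leading [00] or [01]), and
    so does [rfact th n * lambda th n].  Since the weight is a product, once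
    [a_(r+1) = 0] the word [a_r ... a_1] is independent of the earlier bits: it
    lies in [Delta_r] (weight [d_r]) or is a one followed by a word of
    [Delta_(r-1)] (weight [th d_(r-1)]).  This is the transition law.

    For (ii), the spacings of [1 a_n ... a_1] have the Ewens law (the Feller
    coupling), and [Delta_n] is the event that there is no 1-spacing.  Reading the
    word from the top, the first gap has length [d] with a size-biased
    probability, because [th * pweight (c - e_d) = d c_d * pweight c] and
    [sum_d d c_d = n]. *)

(** * Product weights of 0-1 words *)

Section Weights.
Context {R : realFieldType}.
Variable th : R.
Hypothesis hth : 0 < th.

(* The bit [u_k] sits at index [i = r + k + 1], so a zero there weighs [i - 1]. *)
Definition wt (r : nat) (u : seq bool) : R :=
  \prod_(k < size u) (if nth false u k then th else (r + k)%:R).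

(** The predicate is on plain sequences, so that words can be cut and extended without casts between
    tuple types. *)
Definition wsum (n : nat) (P : pred (seq bool)) : R :=
  \sum_(t : n.-tuple bool | P t) wt 0 t.

Lemma wt_rcons r u b :
  wt r (rcons u b) = wt r u * (if b then th else (r + size u)%:R).
Proof.
rewrite /wt size_rcons big_ord_recr /= nth_rcons ltnn eqxx.
by congr (_ * _); apply: eq_bigr => i _; rewrite nth_rcons ltn_ord.
Qed.

Lemma wt_ge0 r u : 0 <= wt r u.
Proof. by apply: prodr_ge0 => i _; case: ifP => _; rewrite ?ler0n ?ltW. Qed.

Lemma wt_head_false t : (0 < size t)%N -> ~~ nth false t 0 -> wt 0 t = 0.
Proof.
by case: t => // a t _ /= /negbTE ->; rewrite /wt big_ord_recl /= mul0r.
Qed.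

Lemma rfact_gt0 m : 0 < rfact th m.
Proof. by apply: prodr_gt0 => i _; rewrite ltr_wpDr ?ler0n. Qed.

Lemma rfactS m : rfact th m.+1 = rfact th m * (th + m%:R).
Proof. by rewrite /rfact big_ord_recr. Qed.

Lemma xi_weightE n (t : n.-tuple bool) :
  xi_weight th n t = wt 0 t / rfact th n.
Proof.
rewrite /xi_weight /wt /rfact size_tuple -prodf_div.
by apply: eq_bigr => k _; rewrite add0n; case: ifP.
Qed.

Lemma PEtaE n (E : pred (n.-tuple bool)) :
  PEta th n E = (\sum_(t : n.-tuple bool | inDelta t && E t) wt 0 t) /
                (\sum_(t : n.-tuple bool | inDelta t) wt 0 t).
Proof.
rewrite /PEta; under eq_bigr do rewrite xi_weightE.
under [X in _ / X]eq_bigr do rewrite xi_weightE.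
rewrite -!mulr_suml invfM invrK mulrACA [X in _ * X]mulrC divff ?mulr1 //.
by rewrite gt_eqF ?rfact_gt0.
Qed.

Lemma eq_wsum n (P Q : pred (seq bool)) :
  (forall t, size t = n -> P t = Q t) -> wsum n P = wsum n Q.
Proof. by move=> eqPQ; apply: eq_bigl => t; rewrite eqPQ ?size_tuple. Qed.

Lemma wsum_pred0 n (P : pred (seq bool)) :
  (forall t, size t = n -> ~~ P t) -> wsum n P = 0.
Proof.
move=> P0; rewrite /wsum big_pred0 // => t.
by rewrite (negbTE (P0 _ _)) ?size_tuple.
Qed.

Lemma wsum_ge0 n P : 0 <= wsum n P.
Proof. by apply: sumr_ge0 => t _; apply: wt_ge0. Qed.

Lemma wsum0 P : wsum 0 P = (P [::])%:R.
Proof.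
rewrite /wsum big_mkcond (big_pred1 [tuple]) => [|t]; last exact/esym/eqP/tuple0.
by rewrite /wt /= big_ord0; case: (P _).
Qed.

(** Storage starts at [a_1], so [rcons] adds the top bit, of index [n.+1]. *)
Lemma wsumS n P :
  wsum n.+1 P = th * wsum n (fun t => P (rcons t true)) +
                n%:R * wsum n (fun t => P (rcons t false)).
Proof.
pose f (x : n.-tuple bool * bool) := [tuple of rcons x.1 x.2].
pose g (t : n.+1.-tuple bool) :=
  ([tuple of belast (thead t) (behead t)], last (thead t) (behead t)).
have fK : cancel f g.
  case=> s b; have eta : thead (f (s, b)) :: behead (rcons s b) = rcons s b.
    by rewrite -[RHS]/(tval (f (s, b))) {2}[f _]tuple_eta.
  case/rcons_inj: (etrans (esym (lastI _ _)) eta) => eq_s eq_b.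
  by congr pair => //; apply: val_inj.
have gK : cancel g f.
  by move=> t; case: (tupleP t) => a s; apply: val_inj; rewrite /= theadE -lastI.
rewrite /wsum (reindex f) /=; last by exists g => x _.
rewrite big_mkcond /=.
pose F (t : n.-tuple bool) b := if P (rcons t b) then wt 0 (rcons t b) else 0.
rewrite (eq_bigr (fun x => F x.1 x.2)); last by case.
rewrite -(pair_bigA _ F) /F /=.
rewrite exchange_big big_bool /= -!big_mkcond !mulr_sumr.
by congr (_ + _); apply: eq_bigr => t _; rewrite wt_rcons mulrC ?size_tuple.
Qed.

(** Independence: fixing the bits above index [r] splits off their product weight. *)
Lemma wsum_cat r u P :
  wsum (r + size u) (fun t => (drop r t == u) && P t) =
  wt r u * wsum r (fun s => P (s ++ u)).
Proof.
elim/last_ind: u P => [|u b IHu] P.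
  rewrite addn0 /wt big_ord0 mul1r; apply: eq_wsum => t sz.
  by rewrite cats0 drop_oversize ?sz.
have dropE t c : size t = (r + size u)%N ->
    (drop r (rcons t c) == rcons u b) = (drop r t == u) && (c == b).
  by move=> sz; rewrite drop_rcons ?eqseq_rcons // sz leq_addr.
have sumE c : wsum (r + size u)
    (fun t => (drop r (rcons t c) == rcons u b) && P (rcons t c)) =
    if c == b then wt r u * wsum r (fun s => P (s ++ rcons u b)) else 0.
  case: eqP => [->|/eqP ncb]; last first.
    by apply: wsum_pred0 => t sz; rewrite dropE // (negbTE ncb) andbF.
  rewrite (@eq_wsum _ _ (fun t => (drop r t == u) && P (rcons t b))); last first.
    by move=> t sz; rewrite dropE // eqxx andbT.
  rewrite IHu; congr (_ * _).
  by apply: eq_wsum => s _; rewrite rcons_cat.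
rewrite size_rcons addnS wsumS !sumE wt_rcons.
by case: b {dropE sumE} => /=; rewrite mulr0 ?addr0 ?add0r; ring.
Qed.

(** * The normalising constant *)

(** The top bit is left free. Appending a virtual [a_(n+1) = 1] forces [a_n = 0] and so recovers
    [Delta_n]. *)
Definition good (s : seq bool) :=
  nth false s 0 && sorted (fun x y => ~~ (x && y)) s.

Lemma good_rcons_true s b : good (rcons (rcons s b) true) = ~~ b && good (rcons s b).
Proof.
rewrite /good; case: s => [|a s] /=; first by case: b.
rewrite !rcons_path !last_rcons andbT.
by case: a; case: b; rewrite /= ?andbF ?andbT.
Qed.

Lemma good_rcons_false s : (0 < size s)%N -> good (rcons s false) = good s.
Proof. by case: s => // a s _; rewrite /good /= rcons_path andbF andbT. Qed.

Lemma good_cat s u : (0 < size s)%N -> ~~ nth false u 0 ->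
  good (s ++ u) = good s && sorted (fun x y => ~~ (x && y)) u.
Proof.
case: s => // a s _; rewrite /good /= cat_path.
by case: u => [|[] u] //= _; rewrite ?andbF -?andbA ?andbT.
Qed.

Lemma inDeltaE n (t : n.-tuple bool) : (0 < n)%N -> inDelta t = good (rcons t true).
Proof.
move=> n0; have szt : size t = n by rewrite size_tuple.
have nthE i : (i < n)%N -> nth false (rcons t true) i = nth false t i.
  by move=> lt_in; rewrite nth_rcons szt lt_in.
rewrite /inDelta /good /Defs.comp /= nthE // andbCA; congr (_ && _).
apply/idP/(sortedP false).
  case/andP => tn /forallP adj i; rewrite size_rcons szt ltnS => lt_in.
  rewrite nthE // nth_rcons szt; move: lt_in; rewrite leq_eqVlt.
  case/orP => [/eqP e|lt_in].
    by rewrite e ltnn eqxx andbT (congr1 predn e : i = n.-1).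
  rewrite lt_in; have := adj (Ordinal (lt_in : i.+2 < n.+1)%N).
  by rewrite /= andbC.
move=> adj; apply/andP; split.
  have := adj n.-1; rewrite size_rcons szt prednK // => /(_ (leqnn _)).
  by rewrite nthE ?prednK // nth_rcons szt ltnn eqxx andbT.
apply/forallP => -[[|[|i]] //= lt_i].
have := adj i; rewrite size_rcons szt => /(_ (ltnW lt_i)).
by rewrite !nthE 1?andbC // ltnW.
Qed.

(** The virtual top one also gives a value at 0, namely 1, in agreement with [lambda th 0 = 1]. *)
Definition dsum n := wsum n (fun t => good (rcons t true)).

Lemma sum_inDelta n : (0 < n)%N ->
  \sum_(t : n.-tuple bool | inDelta t) wt 0 t = dsum n.
Proof. by move=> n0; apply: eq_bigl => t; rewrite inDeltaE. Qed.

Lemma dsumS n : dsum n.+1 = n%:R * wsum n good.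
Proof.
rewrite /dsum wsumS wsum_pred0 => [|t _]; last by rewrite good_rcons_true.
rewrite mulr0 add0r; case: n => [|n]; first by rewrite !mul0r.
congr (_ * _); apply: eq_wsum => t sz.
by rewrite good_rcons_true good_rcons_false ?sz.
Qed.

(** A top one sits on a word of [Delta_n]; a top zero puts the whole word in [Delta_(n+1)]. *)
Lemma wsum_good_last n b : wsum n.+1 (fun t => good t && (last false t == b)) =
  if b then th * dsum n else dsum n.+1.
Proof.
rewrite wsumS dsumS.
case: b; [rewrite addrC|]; rewrite [X in _ * X + _]wsum_pred0 ?mulr0 ?add0r.
- by congr (_ * _); apply: eq_wsum => t _; rewrite last_rcons andbT.
- by move=> t _; rewrite last_rcons andbF.
- case: n => [|n]; first by rewrite !mul0r.
  by congr (_ * _); apply: eq_wsum => t sz; rewrite last_rcons andbT good_rcons_false ?sz.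
- by move=> t _; rewrite last_rcons andbF.
Qed.

Lemma wsum_good n : wsum n.+1 good = th * dsum n + dsum n.+1.
Proof.
rewrite -(wsum_good_last n true) -(wsum_good_last n false) /wsum.
rewrite (bigID (fun t : n.+1.-tuple bool => last false t)) /=.
by congr (_ + _); apply: eq_bigl => t; case: (last _ _).
Qed.

Lemma dsumSS n : dsum n.+2 = n.+1%:R * (dsum n.+1 + th * dsum n).
Proof. by rewrite dsumS wsum_good addrC. Qed.

Lemma dsum0 : dsum 0 = 1. Proof. by rewrite /dsum wsum0. Qed.
Lemma dsum1 : dsum 1 = 0. Proof. by rewrite dsumS mul0r. Qed.

Lemma dsum_gt0 n : 0 < dsum n.+2.
Proof.
elim: n => [|n IHn]; first by rewrite dsumSS dsum1 dsum0 add0r mulr1 mul1r.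
by rewrite dsumSS pmulr_rgt0 ?ltr0n // ltr_pwDl // mulr_ge0 ?wsum_ge0 ?ltW.
Qed.

(* The coefficient of [z^n] in [exp (- th z) (1 - z)^(- th)]; differentiating
   this product gives the recurrence [dsumSS]. *)
Definition dcoef n : R := \sum_(j < n.+1)
  ((-1) ^+ j * th ^+ j / (j`!)%:R * rfact th (n - j) / ((n - j)`!)%:R).

Lemma fact_neq0 n : (n`!)%:R != 0 :> R.
Proof. by rewrite pnatr_eq0 -lt0n fact_gt0. Qed.

Lemma dcoefSS n :
  n.+2%:R * dcoef n.+2 = n.+1%:R * dcoef n.+1 + th * dcoef n.
Proof.
pose a j : R := (-1) ^+ j * th ^+ j / (j`!)%:R.
pose b k : R := rfact th k / (k`!)%:R.
(* [A] and [B] come from differentiating the exponential and the power: [z] times the derivative of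
   the product has coefficients [A + B]. *)
pose A m := \sum_(j < m.+1) (j%:R * a j) * b (m - j)%N.
pose B m := \sum_(j < m.+1) a j * ((m - j)%:R * b (m - j)%N).
have dcoefE m : dcoef m = \sum_(j < m.+1) a j * b (m - j)%N.
  by apply: eq_bigr => j _; rewrite /a /b !mulrA.
have AB m : m%:R * dcoef m = A m + B m.
  rewrite dcoefE mulr_sumr -big_split; apply: eq_bigr => j _ /=.
  by rewrite -{1}(subnKC (leq_ord j)) natrD; ring.
have AS m : A m.+1 = - (th * dcoef m).
  rewrite /A big_ord_recl !mul0r add0r dcoefE mulr_sumr -sumrN.
  apply: eq_bigr => j _; rewrite subSS !mulrA -mulNr; congr (_ * _).
  rewrite /a /= /bump add1n factS natrM !exprS.
  by field; rewrite fact_neq0 nat1r pnatr_eq0.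
have BS m : B m.+1 = th * dcoef m + B m.
  rewrite /B big_ord_recr /= subnn mul0r mulr0 addr0 dcoefE mulr_sumr -big_split.
  apply: eq_bigr => j _ /=; rewrite subSn ?leq_ord //.
  suff -> : (m - j).+1%:R * b (m - j).+1 = (th + (m - j)%:R) * b (m - j)%N by ring.
  rewrite /b rfactS factS natrM.
  by field; rewrite fact_neq0 nat1r pnatr_eq0.
(* The terms in [th * dcoef n.+1] cancel and leave [B n.+1], which is
   [n.+1%:R * dcoef n.+1 - A n.+1]. *)
by rewrite AB AS BS AB AS; ring.
Qed.

Lemma dsum_dcoef n : dsum n = (n`!)%:R * dcoef n.
Proof.
suff: dsum n = (n`!)%:R * dcoef n /\ dsum n.+1 = (n.+1`!)%:R * dcoef n.+1.
  by case.
elim: n => [|n [IHn IHSn]].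
  rewrite dsum0 dsum1 /dcoef !big_ord_recr !big_ord0 /=.
  rewrite /rfact !big_ord_recr !big_ord0 /= !subnn subn0 !fact0 ?factS fact0 expr0 !expr1 muln1.
  by split; field.
split=> //; rewrite dsumSS IHn IHSn [(n.+2)`!]factS mulnC natrM -mulrA dcoefSS.
by rewrite factS natrM; ring.
Qed.

Lemma dsum_lambda n : dsum n = rfact th n * lambda th n.
Proof.
rewrite /lambda; case: eqP => [->|_]; first by rewrite dsum0 /rfact big_ord0 mulr1.
by rewrite dsum_dcoef /dcoef; field; rewrite gt_eqF ?rfact_gt0.
Qed.

(** * Spacings *)

Lemma spacings_false j s : (0 < j)%N -> spacings j (false :: s) = spacings j s.
Proof. by move=> j0; rewrite /spacings big_ord_recl. Qed.

Definition first_gap (j : nat) (s : seq bool) : bool :=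
  nth false s j.-1 && ~~ has id (take j.-1 s).

Lemma spacings_true j s : (0 < j)%N ->
  spacings j (true :: s) = (first_gap j s + spacings j s)%N.
Proof.
move=> j0; rewrite /spacings big_ord_recl /=; congr (nat_of_bool _ + _)%N.
rewrite add0n /first_gap -{1}(prednK j0) /=; congr (_ && _).
apply/forallP/hasPn => [nos x /(nthP false) [k] | nos [[|k] //= lt_kj]].
  rewrite size_take_min leq_min => /andP [lt_kj lt_ks].
  rewrite nth_take // => <-.
  have lt : (k.+1 < j)%N by rewrite -ltn_predRL.
  exact: (nos (Ordinal lt)).
have [lt_ks|?] := ltnP k (size s); last by rewrite nth_default.
apply: nos; rewrite -(@nth_take j.-1) ?ltn_predRL // mem_nth //.
by rewrite size_take_min leq_min ltn_predRL lt_kj.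
Qed.

Lemma first_gap_run j m s : (0 < j)%N ->
  first_gap j (nseq m false ++ true :: s) = (j == m.+1).
Proof.
case: j => // j _; rewrite /first_gap /= eqSS nth_cat size_nseq nth_nseq take_cat size_nseq.
have [lt_jm|le_mj] := ltnP j m; first by rewrite ?if_same /= ltn_eqF.
case: (posnP (j - m)) => [/eqP|gt0].
  rewrite subn_eq0 => le_jm; have -> : j = m by apply/eqP; rewrite eqn_leq le_jm.
  by rewrite subnn /= cats0 eqxx has_nseq andbF.
rewrite -(prednK gt0) /= has_cat /= orbT andbF.
by rewrite gtn_eqF // -subn_gt0.
Qed.

Lemma spacings_nil j : spacings j [::] = 0%N.
Proof. by rewrite /spacings big_ord0. Qed.

Lemma spacings_run0 j m s : (0 < j)%N -> spacings j (nseq m false ++ s) = spacings j s.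
Proof. by move=> j0; elim: m => //= m IHm; rewrite spacings_false. Qed.

Lemma spacings_run j m s : (0 < j)%N ->
  spacings j (true :: nseq m false ++ true :: s) = ((j == m.+1) + spacings j (true :: s))%N.
Proof. by move=> j0; rewrite spacings_true // first_gap_run // spacings_run0. Qed.

Lemma spacings_last j : (0 < j)%N -> spacings j [:: true] = 0%N.
Proof. by move=> j0; rewrite spacings_true // spacings_nil /first_gap nth_nil. Qed.

(** Hence the counts for [true :: rev t] fit in ['I_n.+1], and [inord] in [spacing_vec] keeps their
    values. *)
Lemma spacings_le j s : (0 < j)%N -> (spacings j s <= (size s).-1)%N.
Proof.
move=> j0; rewrite /spacings; case sz: (size s) => [|n].
  by rewrite big_ord0.
rewrite big_ord_recr /= [nth false s (n + j)]nth_default ?andbF ?addn0; last first.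
  by rewrite sz -addn1 leq_add2l.
rewrite -[X in (_ <= X)%N]card_ord -sum1_card.
by apply: leq_sum => i _; case: (_ && _).
Qed.

Lemma good_spacings s : (0 < size s)%N ->
  good (rcons s true) = nth false s 0 && (spacings 1 (true :: rev s) == 0)%N.
Proof.
move=> s0; rewrite /good nth_rcons s0; congr (_ && _).
rewrite -rev_sorted rev_rcons.
(* After reversal the top bit comes first; the bit before it, initially the added one, is
   generalised. *)
elim: {s s0}(rev s) true => [|a s IHs] b.
  by case: b; rewrite ?spacings_last // spacings_false // spacings_nil.
rewrite [LHS]/= -[path _ _ _]/(sorted _ (a :: s)) IHs.
case: b; last by rewrite (@spacings_false 1) // andbF.
by rewrite (@spacings_true 1) // /first_gap /=; case: a.
Qed.

(** * Joint law of the spacings *)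

(* The first gap of [true :: nseq m false ++ rev t] has length more than [m];
   keeping [m] as a parameter lets [t] be read one bit at a time. *)
Definition matches (N m : nat) (c : nat -> nat) (t : seq bool) : bool :=
  all (fun j => spacings j (true :: nseq m false ++ rev t) == c j) (iota 1 N).

Definition pweight (N : nat) (c : nat -> nat) : R :=
  \prod_(1 <= j < N.+1) ((th / j%:R) ^+ c j / ((c j)`!)%:R).

(** Divided by [mass N 1 c], this is the size-biased probability that the first gap has length at
    least [m]. *)
Definition mass (N m : nat) (c : nat -> nat) : nat :=
  \sum_(m <= j < N.+1) j * c j.

Definition dec (d : nat) (c : nat -> nat) (j : nat) : nat := (c j - (j == d))%N.

Lemma matches_false N m c t : matches N m c (rcons t false) = matches N m.+1 c t.
Proof.
rewrite /matches rev_rcons; suff -> : nseq m false ++ false :: rev t = nseq m.+1 false ++ rev t by [].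
by elim: m => //= m ->.
Qed.

(** The top one closes a first gap of length [m.+1]. Positivity of [c m.+1] is stated because the
    subtraction in [dec] truncates. *)
Lemma matches_true N m c t : (m < N)%N ->
  matches N m c (rcons t true) = (0 < c m.+1)%N && matches N 0 (dec m.+1 c) t.
Proof.
move=> lt_mN; rewrite /matches rev_rcons.
have [c0|c_gt0] := posnP (c m.+1).
  apply/negbTE/allPn; exists m.+1; first by rewrite mem_iota add1n.
  by rewrite spacings_run // eqxx c0.
apply: eq_in_all => j; rewrite mem_iota => /andP [j0 _].
rewrite spacings_run //= /dec; case: (j =P m.+1) => [->|_]; last by rewrite subn0.
by rewrite -(eqn_add2l 1 _ (c _ - _)) subnKC.
Qed.

Lemma mass_dec N m d c : (m <= d <= N)%N -> (0 < c d)%N ->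
  mass N m c = (d + mass N m (dec d c))%N.
Proof.
move=> /andP [le_md le_dN] c_gt0; rewrite /mass.
rewrite !(@big_cat_nat _ _ _ d m N.+1) ?leqW //=.
rewrite !(@big_ltn _ _ _ d) ?ltnS // /dec eqxx.
have -> : (d * c d = d + d * (c d - true))%N.
  by rewrite mulnBr muln1 subnKC // leq_pmulr.
rewrite -(addnA d) addnCA; congr (_ + (_ + (_ + _)))%N.
- rewrite !big_nat; apply: eq_bigr => j /andP [_ lt_jd].
  by rewrite ltn_eqF ?subn0.
- rewrite !big_nat; apply: eq_bigr => j /andP [lt_dj _].
  by rewrite gtn_eqF ?subn0.
Qed.

Lemma pweight_dec N d c : (0 < d <= N)%N -> (0 < c d)%N ->
  th * pweight N (dec d c) = (d * c d)%:R * pweight N c.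
Proof.
move=> /andP [d_gt0 le_dN] c_gt0; rewrite /pweight.
rewrite !(@big_cat_nat _ _ _ d 1 N.+1) ?leqW //=.
rewrite !(@big_ltn _ _ _ d) ?ltnS // /dec eqxx.
set x := \prod_(1 <= i < d) _; set y := \prod_(d.+1 <= i < _) _.
have -> : \prod_(1 <= i < d) ((th / i%:R) ^+ c i / ((c i)`!)%:R) = x.
  rewrite /x !big_nat; apply: eq_bigr => j /andP [_ lt_jd].
  by rewrite ltn_eqF ?subn0.
have -> : \prod_(d.+1 <= i < N.+1) ((th / i%:R) ^+ c i / ((c i)`!)%:R) = y.
  rewrite /y !big_nat; apply: eq_bigr => j /andP [lt_dj _].
  by rewrite gtn_eqF ?subn0.
rewrite -(prednK c_gt0) subn1 /= factS !natrM exprS.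
by field; rewrite fact_neq0 nat1r !pnatr_eq0 -!lt0n d_gt0.
Qed.

(* The factor [n] makes the formula hold at [n = 0] too, which the induction needs:
   there [matches N m c [::]] may hold although the tail mass is zero. *)
Definition matches_formula N n m c : Prop :=
  n%:R * wsum n (matches N m c) =
  if mass N 1 c == (n + m)%N then (n`!)%:R * pweight N c * (mass N m.+1 c)%:R else 0.

Lemma wsum_matches0 N n c : matches_formula N n 0 c ->
  wsum n (matches N 0 c) = if mass N 1 c == n then (n`!)%:R * pweight N c else 0.
Proof.
rewrite /matches_formula addn0; case: n => [_|n formula]; last first.
  have n0 : n.+1%:R != 0 :> R by rewrite pnatr_eq0.
  apply: (mulfI n0); rewrite formula.
  by case: eqP => [->|_]; rewrite ?mulr0 // mulrC.
(* The empty word has no spacings, so it matches only if [c] vanishes on [1..N]. *)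
rewrite wsum0; have -> : matches N 0 c [::] = (mass N 1 c == 0)%N.
  rewrite /mass sum_nat_seq_eq0 /matches /index_iota subn1 /=.
  apply: eq_in_all => j; rewrite mem_iota => /andP [j0 _].
  rewrite muln_eq0 eqn0Ngt j0 /= /rev /= spacings_last // eq_sym.
case: eqP => // massE; rewrite fact0 mul1r /pweight big_nat big1 // => j /andP [j0 lt_jN].
case: (posnP (c j)) => [->|c_gt0]; first by rewrite expr0 fact0 invr1 mulr1.
by move: massE; rewrite (@mass_dec _ _ j) //; [lia | rewrite j0].
Qed.

(** A top zero lengthens the running gap and yields the tail mass from [m.+2] on; a top one closes
    it and yields, by [pweight_dec], the missing term [m.+1 * c m.+1]. *)
Lemma wsum_matches_mul N n m c : (n + m <= N)%N -> matches_formula N n m c.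
Proof.
elim: n m c => [|n IHn] m c le_N; rewrite /matches_formula.
  rewrite mul0r add0n; case: eqP => // massE.
  suff -> : mass N m.+1 c = 0%N by rewrite mulr0.
  rewrite /mass big_nat big1 // => j /andP [lt_mj lt_jN].
  apply/eqP; rewrite muln_eq0; case: (posnP (c j)) => c_gt0; first by rewrite orbT.
  move: massE; rewrite (@mass_dec _ _ j) //; last by rewrite (leq_trans _ lt_mj).
  by lia.
have lt_mN : (m < N)%N by rewrite (leq_trans _ le_N) // ltnS leq_addl.
rewrite wsumS (@eq_wsum _ (fun t => matches N m c (rcons t false)) (matches N m.+1 c)); last first.
  by move=> t _; rewrite matches_false.
have -> : mass N m.+1 c = (m.+1 * c m.+1 + mass N m.+2 c)%N by rewrite /mass big_ltn.
rewrite IHn -?addSnnS // factS !natrM natrD.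
have [c0|c_gt0] := posnP (c m.+1).
  rewrite wsum_pred0 => [|t _]; last by rewrite matches_true // c0.
  by rewrite c0 muln0; case: ifP => _; rewrite ?mulr0 ?addr0 //; ring.
rewrite (@eq_wsum _ _ (matches N 0 (dec m.+1 c))) => [|t _]; last first.
  by rewrite matches_true // c_gt0.
rewrite wsum_matches0; last by apply: IHn; rewrite addn0; lia.
rewrite (@mass_dec N 1 m.+1 c) // (addnC n.+1) -addSnnS eqn_add2l.
case: ifP => _; last by rewrite !mulr0 addr0 mulr0.
by rewrite [th * _]mulrCA pweight_dec //; ring.
Qed.

(** The Feller coupling, before division by [rfact th n]. *)
Lemma wsum_matches n c :
  wsum n (matches n 0 c) = rfact th n * esf_pmf th n c.
Proof.
rewrite wsum_matches0; last by apply: wsum_matches_mul; rewrite addn0.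
rewrite /esf_pmf -/(mass n 1 c); case: ifP => _; last by rewrite mulr0.
by rewrite /pweight; field; rewrite gt_eqF ?rfact_gt0.
Qed.

(** * Passage to Ewens probabilities *)

Definition spacing_vec n (t : n.-tuple bool) : n.-tuple 'I_n.+1 :=
  [tuple inord (spacings i.+1 (true :: rev t)) | i < n].

Lemma cvec_nth n (d : n.-tuple 'I_n.+1) (i : 'I_n) : cvec d i.+1 = tnth d i.
Proof.
by rewrite /cvec /= ltn_ord (nth_map ord0) ?size_tuple // -tnth_nth.
Qed.

Lemma cvec_spacing_vec n (t : n.-tuple bool) j : (0 < j <= n)%N ->
  cvec (spacing_vec n t) j = spacings j (true :: rev t).
Proof.
case: j => // j lt_jn; rewrite (cvec_nth _ _ (Ordinal (lt_jn : (j < n)%N))) tnth_mktuple.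
by rewrite inordK // ltnS (leq_trans (spacings_le _ _ _)) //= size_rev size_tuple.
Qed.

Lemma matches_cvec n (t : n.-tuple bool) (d : n.-tuple 'I_n.+1) :
  matches n 0 (cvec d) t = (d == spacing_vec n t).
Proof.
apply/allP/eqP => [mt|-> j]; last first.
  rewrite mem_iota add1n ltnS => lt_j.
  by rewrite cvec_spacing_vec.
apply: eq_from_tnth => i; apply: val_inj => /=.
rewrite -!cvec_nth cvec_spacing_vec ?ltn_ord //; apply/esym/eqP/mt.
by rewrite mem_iota add1n ltn0Sn ltnS ltn_ord.
Qed.

(** The Ewens sum over count vectors groups the words by the fibres of [spacing_vec]. *)
Lemma PESF_spacings n (E : (nat -> nat) -> bool) :
  PESF th n E =
  (\sum_(t : n.-tuple bool | E (cvec (spacing_vec n t))) wt 0 t) / rfact th n.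
Proof.
rewrite /PESF mulr_suml.
have esfE d : esf_pmf th n (cvec d) =
    \sum_(t : n.-tuple bool | spacing_vec n t == d) wt 0 t / rfact th n.
  rewrite -mulr_suml (eq_bigl (fun t : n.-tuple bool => matches n 0 (cvec d) t)).
    rewrite -/(wsum _ _) wsum_matches mulrAC divff ?mul1r //.
    by rewrite gt_eqF ?rfact_gt0.
  by move=> t; rewrite matches_cvec eq_sym.
rewrite (eq_bigr _ (fun d _ => esfE d)).
rewrite (partition_big (spacing_vec n) (fun d => E (cvec d))) //=.
apply: eq_bigr => d Ed; apply: eq_bigl => t.
by case: eqP => [->|_]; rewrite ?Ed ?andbF.
Qed.

Lemma PESF_no_fixpoint n (E : (nat -> nat) -> bool) : (0 < n)%N ->
  PESF th n (fun d => (d 1 == 0)%N && E d) =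
  (\sum_(t : n.-tuple bool | inDelta t && E (cvec (spacing_vec n t))) wt 0 t) / rfact th n.
Proof.
move=> n0; rewrite PESF_spacings; congr (_ / _).
rewrite big_mkcond [RHS]big_mkcond; apply: eq_bigr => t _.
rewrite inDeltaE // good_spacings ?size_tuple // cvec_spacing_vec ?n0 //.
(* Words with [a_1 = 0] may lack 1-spacings and yet lie outside [Delta_n], but their weight is 0. *)
case t0: (nth false t 0) => //=.
by rewrite (wt_head_false t) ?size_tuple ?t0 ?if_same.
Qed.
(** * Conditioning on the past *)

Lemma sum_inDelta_neq0 n : (1 < n)%N ->
  \sum_(t : n.-tuple bool | inDelta t) wt 0 t != 0.
Proof.
by case: n => [|[|n]] // _; rewrite sum_inDelta // gt_eqF // dsum_gt0.
Qed.

Lemma PEta_sure n (E : pred (n.-tuple bool)) : (1 < n)%N ->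
  (forall t : n.-tuple bool, inDelta t -> E t) -> PEta th n E = 1.
Proof.
move=> n1 sureE; rewrite PEtaE (eq_bigl (@inDelta n)) ?divff ?sum_inDelta_neq0 // => t.
by case Dt: (inDelta t) => //=; rewrite sureE.
Qed.

Lemma PEtaCondE n (E F : pred (n.-tuple bool)) : (1 < n)%N ->
  PEtaCond th n E F =
  (\sum_(t : n.-tuple bool | inDelta t && (E t && F t)) wt 0 t) /
  (\sum_(t : n.-tuple bool | inDelta t && F t) wt 0 t).
Proof.
move=> n1; rewrite /PEtaCond !PEtaE invfM invrK mulrACA [X in _ * X]mulrC.
by rewrite divff ?mulr1 // sum_inDelta_neq0.
Qed.

Definition past_eq n (r : nat) (h : nat -> bool) (t : n.-tuple bool) : bool :=
  [forall i : 'I_n.+2, (r < i)%N ==> (etav t i == h i)].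

(** Indices [r+1] to [n] in storage order; in the order of the chain these bits are the past. *)
Definition future_vals n (r : nat) (h : nat -> bool) : seq bool :=
  mkseq (fun k => h (r + k).+1) (n - r).

Lemma past_eq_drop n r h (t : n.-tuple bool) : (r <= n)%N ->
  past_eq n r h t = h n.+1 && (drop r t == future_vals n r h).
Proof.
move=> le_rn; apply/forallP/andP => [past|[hn /eqP dropE] [i lt_i]].
  split.
    by have := past ord_max; rewrite /= ltnS le_rn /etav eqxx eq_sym eqb_id.
  apply/eqP/(@eq_from_nth _ false); first by rewrite size_drop size_mkseq size_tuple.
  rewrite size_drop size_tuple => k; rewrite ltn_subRL => lt_k.
  rewrite nth_drop nth_mkseq ?ltn_subRL //.
  have lt_k2 : ((r + k).+1 < n.+2)%N by rewrite ltnS leqW.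
  have := past (Ordinal lt_k2); rewrite /= ltnS leq_addr /etav eqSS ltn_eqF //.
  by move/eqP.
apply/implyP => /= lt_ri; rewrite /etav; case: (i =P n.+1) => [->|/eqP ne_in]; first by rewrite hn.
have lt_in : (i < n.+1)%N by rewrite ltn_neqAle ne_in -ltnS.
case: i lt_ri lt_in {lt_i ne_in} => // i; rewrite !ltnS => le_ri lt_in.
rewrite /Defs.comp /= -(subnKC le_ri) -nth_drop dropE nth_mkseq ?subnKC //.
by rewrite ltn_sub2r // (leq_ltn_trans le_ri).
Qed.

Lemma past_after_one n r (h : nat -> bool) (t : n.-tuple bool) : (1 <= r < n)%N -> h r.+1 ->
  inDelta t && past_eq n r h t -> ~~ etav t r.
Proof.
move=> /andP [r0 lt_rn] hr /andP [/and3P [_ _ /forallP adj] /forallP past].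
have lt1 : (r.+1 < n.+1)%N by [].
have := past (Ordinal (leqW lt1)); have := adj (Ordinal lt1).
rewrite /= ltnS r0 ltnSn hr /etav eqSS (ltn_eqF lt_rn) ltn_eqF ?leqW //.
by move=> /[swap] /eqP ->.
Qed.

(* Every word of [Delta_n] with the given past and [a_(r+1) = 0] splits into
   that past and an arbitrary [good] word of length [r]. *)
Lemma sum_past_zero n r (h : nat -> bool) : (0 < r < n)%N -> ~~ h r.+1 ->
  exists K : R, forall Q : pred bool,
  \sum_(t : n.-tuple bool | inDelta t && (Q (etav t r) && past_eq n r h t)) wt 0 t =
  K * wsum r (fun s => good s && Q (last false s)).
Proof.
move=> /andP [r0 lt_rn] hr; set u := future_vals n r h.
have szu : size u = (n - r)%N by rewrite size_mkseq.
have nE : (r + size u)%N = n by rewrite szu subnKC // ltnW.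
have u0 : ~~ nth false (rcons u true) 0.
  by rewrite nth_rcons szu subn_gt0 lt_rn nth_mkseq ?subn_gt0 // addn0.
(* [K] gathers the constraints on the past alone: since [u] starts with a zero, no adjacency
   condition links it to the lower word. *)
pose K := h n.+1 && sorted (fun x y => ~~ (x && y)) (rcons u true).
exists (wt r u * K%:R) => Q.
pose P t := [&& good (rcons t true), Q (nth false t r.-1) & h n.+1].
have -> : \sum_(t : n.-tuple bool | inDelta t && (Q (etav t r) && past_eq n r h t)) wt 0 t =
    wsum n (fun t => (drop r t == u) && P t).
  apply: eq_bigl => t; rewrite inDeltaE ?(leq_trans _ lt_rn) // past_eq_drop 1?ltnW //.
  rewrite /P /etav ltn_eqF ?leqW // /Defs.comp.
  by rewrite [RHS]andbC -!andbA.
rewrite -{1}nE wsum_cat -mulrA; congr (_ * _).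
rewrite (@eq_wsum _ _ (fun s => K && (good s && Q (last false s)))) => [|s sz].
  by case: K; rewrite ?mul1r // mul0r wsum_pred0.
rewrite /P rcons_cat good_cat ?sz // nth_cat sz ltn_predL r0 -nth_last sz /K.
by rewrite andbACA [RHS]andbC (andbC (sorted _ _)).
Qed.

(** Positive probability of the past makes [K] nonzero, so it cancels in the ratio, as does the
    factor [rfact th r.-1] common to [d_r] and [d_(r-1)]. *)
Lemma transition_zero n r (h : nat -> bool) b : (1 < r < n)%N -> ~~ h r.+1 ->
  0 < PEta th n (past_eq n r h) ->
  PEtaCond th n (fun t => etav t r == b) (past_eq n r h) =
  (if b then th * lambda th r.-1 else (th + r.-1%:R) * lambda th r) /
  ((th + r.-1%:R) * lambda th r + th * lambda th r.-1).
Proof.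
move=> /andP [r1 lt_rn] hr; have n1 : (1 < n)%N by rewrite (ltn_trans r1).
have [|K sumE] := @sum_past_zero n r h _ hr; first by rewrite (ltnW r1).
rewrite PEtaE PEtaCondE // (sumE (eq_op^~ b)).
have := sumE predT; rewrite /= => ->.
rewrite (@eq_wsum _ _ good) => [|t _]; last by rewrite andbT.
case: r r1 {lt_rn hr sumE} => // r r1 /= /gt_eqF.
move=> /negbT; rewrite mulf_eq0 negb_or => /andP [].
rewrite wsum_good_last mulf_eq0 negb_or wsum_good !dsum_lambda rfactS.
move=> /andP [K0 D0] _.
have E0 : (th + r%:R) * lambda th r.+1 + th * lambda th r != 0.
  apply: contraNneq D0 => E0; apply/eqP.
  by rewrite -[RHS](mulr0 (rfact th r)) -E0; ring.
by case: b; field; rewrite E0 D0 K0.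
Qed.

End Weights.

Theorem theorem1 (R : realFieldType) (th : R) (n : nat) (hth : 0 < th) (hn : (3 <= n)%N) :
  (* (i) eta_n = 0 a.s., eta_2 = 0 a.s., eta_1 = 1 a.s. *)
  [/\ PEta th n (fun t => ~~ etav t n) = 1,
      PEta th n (fun t => ~~ etav t 2) = 1,
      PEta th n (fun t => etav t 1) = 1,
  (* (i) Markov property with the stated transitions, for r = 3..n-1:
     conditionally on the whole past (eta_{n+1},...,eta_{r+1}) = (h (n+1),...,h (r+1)),
     the law of eta_r depends only on h (r+1) and is as stated *)
      (forall (r : nat) (h : nat -> bool) (b : bool),
         (3 <= r <= n.-1)%N ->
         let past := fun t : n.-tuple bool =>
           [forall i : 'I_n.+2, (r < i)%N ==> (etav t i == h i)] in
         0 < PEta th n past ->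
         PEtaCond th n (fun t => etav t r == b) past =
           (let D := (th + r.-1%:R) * lambda th r + th * lambda th r.-1 in
            if h r.+1 then (if b then 0 else 1)
            else if b then th * lambda th r.-1 / D
                 else (th + r.-1%:R) * lambda th r / D)) &
  (* (ii) spacing counts of 1 eta_n ... eta_1 have the law of
     (C_2(n),...,C_n(n)) under ESF(theta) conditioned on C_1(n) = 0 *)
      forall c : nat -> nat,
        PEta th n (fun t => [forall j : 'I_n.+1, (2 <= j)%N ==>
                               (spacings j (true :: rev t) == c j)]) =
        PESF th n (fun d => (d 1%N == 0%N) &&
                     [forall j : 'I_n.+1, (2 <= j)%N ==> (d j == c j)]) /
        PESF th n (fun d => d 1%N == 0%N)].
Proof.
have n1 : (1 < n)%N by apply: ltnW.
split.
- apply: PEta_sure => // t /and3P [tn _ _].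
  by rewrite /etav ltn_eqF.
- apply: PEta_sure => // t /and3P [_ t1 /forallP adj].
  have := adj (Ordinal (n1 : (2 < n.+1)%N)).
  by rewrite /etav ltn_eqF /= ?t1 ?andbT // ltnS.
- apply: PEta_sure => // t /and3P [_ t1 _].
  by rewrite /etav ltn_eqF // ltnS ltnW.
- move=> r h b /andP [r3 le_rn] past; rewrite -[past]/(past_eq n r h) => past_gt0.
  have lt_rn : (r < n)%N by rewrite (leq_ltn_trans le_rn) // ltn_predL ltnW.
  have r1 : (1 < r)%N by apply: ltnW.
  case hr: (h r.+1); last first.
    by rewrite transition_zero ?r1 ?hr //; case: (b).
  have r0n : (1 <= r < n)%N by rewrite ltnW.
  have after t := @past_after_one n r h t r0n hr.
  (* The past has nonzero weight, and by [after] every word counted in it has a zero at [r]. *)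
  move: past_gt0; rewrite PEtaCondE // PEtaE // => /gt_eqF /negbT.
  rewrite mulf_eq0 negb_or => /andP [past_neq0 _].
  case: b; last first.
    rewrite -[RHS](divff past_neq0); congr (_ / _); apply: eq_bigl => t.
    have := after t; rewrite /=; case: (inDelta t) => //=.
    by case: (past_eq _ _ _ _); rewrite ?andbF // andbT eqbF_neg => ->.
  rewrite big_pred0 ?mul0r // => t; have := after t.
  case: (inDelta t) => //=; case: (past_eq _ _ _ _); rewrite ?andbF // andbT eqb_id.
  by move=> /(_ isT) /negbTE.
move=> c.
have denE : PESF th n (fun d => d 1%N == 0%N) =
    (\sum_(t : n.-tuple bool | inDelta t) wt th 0 t) / rfact th n.
  have := PESF_no_fixpoint th hth n (fun=> true) (ltnW n1).
  rewrite (eq_bigl (@inDelta n)) => [<-|t]; last by rewrite andbT.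
  by apply: eq_bigl => d; rewrite andbT.
rewrite denE (PESF_no_fixpoint th hth n (fun d => [forall j : 'I_n.+1, (2 <= j)%N ==> (d j == c j)])) 1?ltnW //.
(* The factor [rfact th n] cancels, and both sides become quotients of weights over [Delta_n]. *)
rewrite PEtaE // invfM invrK mulrACA [X in _ = _ * X]mulrC divff ?mulr1; last first.
  by rewrite gt_eqF ?rfact_gt0.
congr (_ / _); apply: eq_bigl => t; congr (_ && _).
apply: eq_forallb => j; case: (ltnP 1 j) => //= j1.
by rewrite cvec_spacing_vec // (ltnW j1) -ltnS ltn_ord.
Qed.
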